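(* Let $\Omega=\{z\in\mathbb{C}:|z|=1\}$, $\psi\in\mathbb{C}$ with $|\psi|<1$, and let $(Z_U,Z_V)$ be a random vector on $\Omega\times\Omega$ with density $$c(z_u,z_v)=\frac{1}{4\pi^2}\,\frac{1-|\psi|^2}{|1-\psi z_v\overline{z_u}|^2},\qquad z_u,z_v\in\Omega.$$ Let $g_1,g_2$ be one-to-one mappings defined on $\Omega$ and differentiable on $\Omega$. Then $g_1(Z_U)$ and $g_2(Z_V)$ are independent if and only if $\psi=0$.
   Context: The density is with respect to arc-length measure on each circle. This distribution is denoted $BC_+(\psi)$. *)

(* Defs.v *)
From HB Require Import structures.
From mathcomp Require Import all_boot all_order all_algebra.
From mathcomp Require Import all_classical all_reals all_analysis.
From mathcomp Require Import complex.
Set Implicit Arguments. Unset Strict Implicit. Unset Printing Implicit Defensive.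
Import Order.TTheory GRing.Theory Num.Theory.
Local Open Scope classical_set_scope.
Local Open Scope ring_scope.

Section BCplus.
Variable R : realType.
Local Notation C := (R[i]).

Definition Omega : set C := [set z | ComplexField.Normc.normc z = 1].

Definition expi (t : R) : C := Complex (cos t) (sin t).

(* density c(z_u,z_v) of BC_+(psi), w.r.t. arc length on each circle *)
Definition bc_density (psi zu zv : C) : R :=
  (1 - ComplexField.Normc.normc psi ^+ 2)
  / (ComplexField.Normc.normc (1 - psi * zv * conjc zu) ^+ 2)
  / (4 * pi ^+ 2).

(* Joint law of (Z_U, Z_V): for A a subset of Omega x Omega (represented in C x C),
   mu(A) = int_{[0,2pi]} int_{[0,2pi]} 1_A(e^{it}, e^{is}) c(e^{it},e^{is}) ds dt,
   i.e. integration of the density against the product of arc-length measures. *)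
Definition twopi : R := pi *+ 2.

Definition bc_law (psi : C) (A : set (C * C)) : \bar R :=
  (\int[lebesgue_measure]_(t in `[0%R, twopi])
     \int[lebesgue_measure]_(s in `[0%R, twopi])
        ((\1_A (expi t, expi s) : R) * bc_density psi (expi t) (expi s))%:E)%E.

(* Borel sets of C, identifying C with R x R (product sigma-algebra = Borel(R^2)) *)
Definition measurableC (B : set C) : Prop :=
  measurable [set p : R * R | B (Complex p.1 p.2)].

Definition indep_images (psi : C) (g1 g2 : C -> C) : Prop :=
  forall B1 B2 : set C, measurableC B1 -> measurableC B2 ->
    bc_law psi [set p | B1 (g1 p.1) /\ B2 (g2 p.2)]
    = (bc_law psi [set p | B1 (g1 p.1)] * bc_law psi [set p | B2 (g2 p.2)])%E.

(* g : Omega -> C is differentiable on Omega (as a map on the circle):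
   t |-> g(e^{it}) is differentiable, i.e. its real and imaginary parts are. *)
Definition diff_on_Omega (g : C -> C) : Prop :=
  forall t : R, derivable (fun s : R => complex.Re (g (expi s))) t 1 /\
                derivable (fun s : R => complex.Im (g (expi s))) t 1.

End BCplus.

(* Main.v *)
(** If [psi = r * exp(i a)] with [0 < r < 1], the density at [(exp(i t), exp(i s))] is
    an increasing function of [cos (s - t + a)].  Independence forces
    [P(I x J) P(I' x J') = P(I x J') P(I' x J)] for all arcs [I, I', J, J'], since both
    sides are the product of the same four marginal probabilities: the marginals
    themselves never have to be computed.  Short arcs with [s - t + a] close to [0] on
    [I x J] and [I' x J'], but bounded away from [0] on [I x J'] and [I' x J], make the
    left-hand side strictly larger.  Events on arcs are events on [g (arc)] because [g]
    is injective and [g (arc)] is compact, hence Borel. *)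
Require Import Defs.
From HB Require Import structures.
From mathcomp Require Import all_boot all_order all_algebra.
From mathcomp Require Import all_classical all_reals all_analysis.
From mathcomp Require Import complex.
From mathcomp Require Import measurable_realfun ring lra.
Import Order.TTheory GRing.Theory Num.Theory.
Import numFieldNormedType.Exports.
Local Open Scope classical_set_scope.
Local Open Scope ring_scope.

(** * Comparison of integrals, and Borel images of arcs *)

(* The integral of a nonnegative function is a supremum over the simple functions
   below it. *)
Lemma ge0_monotone_integral d (T : measurableType d) (R : realType)
    (mu : {measure set T -> \bar R}) (D : set T) (f g : T -> \bar R) :
  (forall x, D x -> (0 <= f x)%E) -> (forall x, D x -> (f x <= g x)%E) ->
  (\int[mu]_(x in D) f x <= \int[mu]_(x in D) g x)%E.
Proof.
move=> f0 fg; rewrite !ge0_integralE//; last first.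
  by move=> x Dx; apply: le_trans (fg x Dx); exact: f0.
apply: ereal_sup_le => _ /= [h hf <-]; exists h => //= x.
by apply: (le_trans (hf x)); exact: lee_restrict.
Qed.

(** Second countability: around each of its points [U] contains a product of two balls with rational
    centres and radii, so [U] is a countable union of measurable rectangles. *)
Lemma open_measurable_prod (R : realType) (U : set (R * R)) :
  open U -> measurable U.
Proof.
move=> oU.
pose B (c r : rat) : set R := ball (ratr c : R) (ratr r).
(* Rational rectangles not contained in [U] are replaced by [set0], so that the union runs over all
   rational parameters. *)
have -> : U = \bigcup_c1 \bigcup_r1 \bigcup_c2 \bigcup_r2
    (if `[< B c1 r1 `*` B c2 r2 `<=` U >] then B c1 r1 `*` B c2 r2 else set0).
  apply/seteqP; split=> [[x y] Uxy|].
    have /= [[P Q] /= [Px Qy] PQU] : nbhs (x, y) U by exact: open_nbhs_nbhs.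
    have [||c1 [r1 [xB BP]]] := @open_subball_rat _ P° x; first exact: open_interior.
      by rewrite inE.
    have [||c2 [r2 [yB BQ]]] := @open_subball_rat _ Q° y; first exact: open_interior.
      by rewrite inE.
    exists c1 => //; exists r1 => //; exists c2 => //; exists r2 => //.
    case: asboolP => [_|]; first by split; exact: set_mem.
    case=> -[u v] [/= /BP/interior_subset Pu /BQ/interior_subset Qv].
    exact: PQU.
  by move=> p [c1 _ [r1 _ [c2 _ [r2 _]]]]; case: asboolP => // BU /BU.
do 4 (apply: bigcupT_measurable_rat => ?).
by case: ifP => // _; apply: measurableX; rewrite /B ball_itv; exact: measurable_itv.
Qed.

Lemma diff_on_Omega_continuous (R : realType) (g : R[i] -> R[i]) :
  diff_on_Omega g -> continuous (fun t : R => complex.Re (g (expi t))) /\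
                     continuous (fun t : R => complex.Im (g (expi t))).
Proof.
by move=> dg; split=> t; apply: differentiable_continuous;
  apply/derivable1_diffP; have [] := dg t.
Qed.

Lemma measurableC_arc_image (R : realType) (g : R[i] -> R[i]) (a b : R) :
  diff_on_Omega g -> Defs.measurableC ((g \o expi (R:=R)) @` `[a, b]).
Proof.
move=> /diff_on_Omega_continuous[cRe cIm]; rewrite /Defs.measurableC.
set F := fun t : R => (complex.Re (g (expi t)), complex.Im (g (expi t))).
have -> : [set p : R * R | ((g \o expi (R:=R)) @` `[a, b]) (Complex p.1 p.2)]
    = F @` `[a, b].
  apply/seteqP; split=> -[x y] /= [t tab].
    by move=> e; exists t => //; rewrite /F e.
  by move=> [<- <-]; exists t => //; case: (g _).
have cF : continuous F by move=> t; exact: (cvg_pair (cRe t) (cIm t)).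
rewrite -[X in measurable X]setCK; apply: measurableC.
apply: open_measurable_prod; apply: closed_openC; apply: compact_closed.
  exact: norm_hausdorff.
apply: continuous_compact; last exact: segment_compact.
exact: continuous_subspaceT.
Qed.

(** * Angles and integrals over rectangles *)

(** Equality of the points gives [cos (t - u) = 1], hence [sin ((t - u) / 2) = 0], whereas [t != u]
    would put [|t - u| / 2] strictly between 0 and [pi]. The strict bounds on [u] exclude the pair
    of angles 0 and [twopi], which name the same point. *)
Lemma expi_inj (R : realType) (t u : R) :
  0 <= t <= twopi R -> 0 < u < twopi R -> expi t = expi u -> t = u.
Proof.
rewrite /twopi => /andP[t0 t2] /andP[u0 u2] [ct st].
have c1 : cos (t - u) = 1.
  by rewrite cosB ct st -!expr2 cos2Dsin2.
have s0 : sin ((t - u) / 2) = 0.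
  apply/eqP; rewrite -sqrf_eq0; apply/eqP; move: c1.
  have -> : t - u = (t - u) / 2 *+ 2 by rewrite -mulr_natr mulfVK.
  rewrite cos_mulr2n -(mulr_natr ((t - u) / 2)) mulfVK//.
  by have := cos2Dsin2 ((t - u) / 2); lra.
case: (ltgtP t u) => // tu.
- have : 0 < sin ((u - t) / 2) by apply: sin_gt0_pi; lra.
  by rewrite -opprB mulNr sinN s0 oppr0 ltxx.
- have : 0 < sin ((t - u) / 2) by apply: sin_gt0_pi; lra.
  by rewrite s0 ltxx.
Qed.

Lemma integral_rectangle (R : realType) (D I J : set R) (k : R) :
  measurable D -> measurable I -> measurable J -> 0 <= k ->
  (\int[lebesgue_measure]_(t in D) \int[lebesgue_measure]_(s in D)
     (\1_I t * \1_J s * k)%:E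
   = lebesgue_measure (I `&` D) * (lebesgue_measure (J `&` D) * k%:E))%E.
Proof.
move=> mD mI mJ k0.
have ik0 (t : R) : 0 <= \1_I t * k by rewrite mulr_ge0.
have inner t : (\int[lebesgue_measure]_(s in D) (\1_I t * \1_J s * k)%:E
    = (\1_I t)%:E * (lebesgue_measure (J `&` D) * k%:E))%E.
  under eq_integral => s _ do rewrite mulrAC EFinM.
  rewrite ge0_integralZl//; last 2 first.
  - by apply/measurable_EFinP; exact: measurable_indic.
  - by rewrite lee_fin.
  by rewrite integral_indic// EFinM -muleA [(k%:E * _)%E]muleC.
under eq_integral => t _ do rewrite inner.
rewrite ge0_integralZr//; first by rewrite integral_indic.
  by apply/measurable_EFinP; exact: measurable_indic.
by rewrite mule_ge0// lee_fin.
Qed.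

(** * Polar form, and the density in terms of angles *)

Lemma normc_sqr (R : realType) (z : R[i]) :
  ComplexField.Normc.normc z ^+ 2 = complex.Re z ^+ 2 + complex.Im z ^+ 2.
Proof. by case: z => x y /=; rewrite sqr_sqrtr// addr_ge0// sqr_ge0. Qed.

Lemma normc_ge0 (R : realType) (z : R[i]) : 0 <= ComplexField.Normc.normc z.
Proof. by case: z => x y /=; exact: sqrtr_ge0. Qed.

(** The angle is [acos (x / r)] up to the sign of [y]. The bound by [pi] later keeps base points of
    the form [pi + a / 2] and [pi - a / 2] away from 0 and [twopi]. *)
Lemma polar (R : realType) (z : R[i]) : exists2 a : R, `|a| <= pi &
  z = Complex (ComplexField.Normc.normc z * cos a)
              (ComplexField.Normc.normc z * sin a).
Proof.
have [->|z0] := eqVneq z 0.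
  by exists 0; rewrite ?normr0 ?pi_ge0// ComplexField.Normc.normc0 !mul0r.
set r := ComplexField.Normc.normc z.
have r2 := @normc_sqr _ z; rewrite -/r in r2.
have r0 : 0 < r.
  rewrite lt0r; apply/andP; split.
    by apply: contra z0 => /eqP/ComplexField.Normc.eq0_normc ->.
  exact: normc_ge0.
case: z z0 @r r2 r0 => x y z0 r /= r2 r0.
set c := x / r.
have xE : x = r * c by rewrite /c mulrCA divff ?mulr1// gt_eqF.
have c2 : (y / r) ^+ 2 = 1 - c ^+ 2.
  have r20 : r ^+ 2 != 0 by rewrite expf_neq0// gt_eqF.
  by rewrite /c !expr_div_n -[1](divff r20) {2}r2 -mulrBl addrAC subrr add0r.
have c1 : -1 <= c <= 1.
  rewrite -ler_norml -(@expr_le1 _ 2)// -normrX ger0_norm ?sqr_ge0//.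
  by rewrite -subr_ge0 -c2 sqr_ge0.
have sE : r * Num.sqrt (1 - c ^+ 2) = `|y|.
  by rewrite -c2 sqrtr_sqr normrM normfV (gtr0_norm r0) mulrCA divff ?mulr1// gt_eqF.
have aN : `|acos c| <= pi by rewrite ger0_norm ?acos_ge0// acos_lepi.
have [y0|y0] := leP 0 y.
  exists (acos c) => //.
  by rewrite acosK ?in_itv//= sin_acos// sE -xE ger0_norm.
exists (- acos c); first by rewrite normrN.
by rewrite cosN sinN acosK ?in_itv//= sin_acos// mulrN sE -xE ltr0_norm// opprK.
Qed.

(** The denominator is the squared modulus of 1 - r exp(i (s - t + a)). *)
Lemma bc_densityE (R : realType) (r a t s : R) :
  bc_density (Complex (r * cos a) (r * sin a)) (expi t) (expi s) =
  (1 - r ^+ 2) / (1 + r ^+ 2 - 2 * r * cos (s - t + a)) / (4 * pi ^+ 2).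
Proof.
rewrite /bc_density !normc_sqr /=.
have h (x : R) := cos2Dsin2 x.
congr (_ / _ / _).
  have -> : r ^+ 2 = r ^+ 2 * (cos a ^+ 2 + sin a ^+ 2) by rewrite h mulr1.
  ring.
rewrite cosD cosB sinB.
(* Inserting factors equal to 1 turns the trigonometric identity into a polynomial one in the sines
   and cosines, which [ring] can check. *)
have -> : 1 + r ^+ 2 = 1 + r ^+ 2 * (cos a ^+ 2 + sin a ^+ 2)
   * (cos s ^+ 2 + sin s ^+ 2) * (cos t ^+ 2 + sin t ^+ 2) by rewrite !h !mulr1.
ring.
Qed.

Lemma bc_density_ge0 (R : realType) (psi zu zv : R[i]) :
  ComplexField.Normc.normc psi < 1 -> 0 <= bc_density psi zu zv.
Proof.
move=> psi1; rewrite /bc_density; apply: divr_ge0; last first.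
  by rewrite mulr_ge0// sqr_ge0.
apply: divr_ge0; last exact: sqr_ge0.
by rewrite subr_ge0 expr_le1 ?normc_ge0// ltW.
Qed.

Lemma bc_law_ge0 (R : realType) (psi : R[i]) (A : set (R[i] * R[i])) :
  ComplexField.Normc.normc psi < 1 -> (0 <= bc_law psi A)%E.
Proof.
move=> psi1; apply: integral_ge0 => t _; apply: integral_ge0 => s _.
by rewrite lee_fin mulr_ge0// bc_density_ge0.
Qed.

Lemma indicE_rect (R : realType) (A : set (R[i] * R[i])) (I J : set R) (t s : R) :
  (A (expi t, expi s) <-> I t /\ J s) ->
  (\1_A (expi t, expi s) : R) = \1_I t * \1_J s.
Proof.
rewrite !indicE => h; rewrite -natrM mulnb; congr (_%:R); congr nat_of_bool.
by apply/idP/andP => [/set_mem/h[? ?]|[/set_mem ? /set_mem ?]];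
  [split; exact: mem_set|apply/mem_set/h].
Qed.

(** * Bounds on the law of rectangles of angles *)

Section bc_law_rectangle.
Context (R : realType) (psi : R[i]) (A : set (R[i] * R[i])) (I J : set R).
Hypothesis psi1 : ComplexField.Normc.normc psi < 1.
Hypotheses (mI : measurable I) (mJ : measurable J).
Let D : set R := `[0, twopi R].
Hypothesis AE : forall t s, D t -> D s -> A (expi t, expi s) <-> I t /\ J s.
Let mu := @lebesgue_measure R.

(** The integrand is compared pointwise with [k] times the indicator of [I] x [J], whose iterated
    integral is explicit. *)
Lemma bc_law_rectangle_ge (k : R) : 0 <= k ->
  (forall t s, I t -> J s -> k <= bc_density psi (expi t) (expi s)) ->
  (mu (I `&` D) * (mu (J `&` D) * k%:E) <= bc_law psi A)%E.
Proof.
move=> k0 hk; rewrite -integral_rectangle//; last exact: measurable_itv.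
have pos (t s : R) : 0 <= \1_I t * \1_J s * k by rewrite !mulr_ge0.
apply: ge0_monotone_integral => t Dt.
  by apply: integral_ge0 => s _; rewrite lee_fin.
apply: ge0_monotone_integral => s Ds; rewrite lee_fin//.
rewrite (indicE_rect _ _ _ _ _ _ (AE _ _ Dt Ds)) !indicE.
have [It|] := boolP (t \in I); last by rewrite !mul0r.
have [Js|] := boolP (s \in J); last by rewrite mulr0 !mul0r.
by rewrite !mul1r hk//; exact: set_mem.
Qed.

Lemma bc_law_rectangle_le (k : R) : 0 <= k ->
  (forall t s, I t -> J s -> bc_density psi (expi t) (expi s) <= k) ->
  (bc_law psi A <= mu (I `&` D) * (mu (J `&` D) * k%:E))%E.
Proof.
move=> k0 hk; rewrite -integral_rectangle//; last exact: measurable_itv.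
have pos (t s : R) :
    (0 <= (\1_A (expi t, expi s) * bc_density psi (expi t) (expi s) : R)%:E)%E.
  by rewrite lee_fin mulr_ge0// bc_density_ge0.
apply: ge0_monotone_integral => t Dt; first exact: integral_ge0.
apply: ge0_monotone_integral => s Ds; first exact: pos.
rewrite lee_fin.
rewrite (indicE_rect _ _ _ _ _ _ (AE _ _ Dt Ds)) !indicE.
have [It|] := boolP (t \in I); last by rewrite !mul0r.
have [Js|] := boolP (s \in J); last by rewrite mulr0 !mul0r.
by rewrite !mul1r hk//; exact: set_mem.
Qed.

End bc_law_rectangle.

(** * Events on images of arcs *)

(** Injectivity of [g] brings the event back to the circle, and [expi_inj] brings it back to angles;
    the strict bounds on [a] and [b] keep the arc off the point with two angles. *)
Lemma arc_imageP (R : realType) (g : R[i] -> R[i]) (a b t : R) :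
  {in @Omega R &, injective g} -> 0 < a -> b < twopi R -> t \in `[0, twopi R] ->
  ((g \o expi (R:=R)) @` `[a, b]) (g (expi t)) <-> t \in `[a, b].
Proof.
move=> ginj a0 b2 /=; rewrite in_itv/= => t02; split; last by exists t.
have Oexpi (u : R) : expi u \in @Omega R.
  by rewrite inE /Omega/= cos2Dsin2 sqrtr1.
move=> [u /[dup] uab]; rewrite /= in_itv/= => /andP[au ub] /ginj gE.
suff -> : t = u by [].
apply: expi_inj => //; first by rewrite (lt_le_trans a0)//= (le_lt_trans ub).
by apply/esym/gE.
Qed.

Lemma indep_images_exchange (R : realType) (psi : R[i]) (g1 g2 : R[i] -> R[i])
    (B1 B2 C1 C2 : set R[i]) :
  indep_images psi g1 g2 ->
  Defs.measurableC B1 -> Defs.measurableC B2 ->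
  Defs.measurableC C1 -> Defs.measurableC C2 ->
  (bc_law psi [set p | B1 (g1 p.1) /\ C1 (g2 p.2)] *
   bc_law psi [set p | B2 (g1 p.1) /\ C2 (g2 p.2)] =
   bc_law psi [set p | B1 (g1 p.1) /\ C2 (g2 p.2)] *
   bc_law psi [set p | B2 (g1 p.1) /\ C1 (g2 p.2)])%E.
Proof.
move=> ind mB1 mB2 mC1 mC2.
rewrite (ind _ _ mB1 mC1) (ind _ _ mB2 mC2) (ind _ _ mB1 mC2) (ind _ _ mB2 mC1).
have ACA (m1 m2 n1 n2 : \bar R) : (m1 * n1 * (m2 * n2) = m1 * n2 * (m2 * n1))%E.
  by rewrite muleACA [RHS]muleACA (muleC n1).
exact: ACA.
Qed.

(** * Independence when [psi = 0] *)

(** The density is the constant [k], so every rectangle has law [k] times the product of its side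
    lengths. Each marginal contributes a full side [twopi], and [twopi R * k * twopi R = 1] absorbs
    the extra factors. *)
Lemma indep_images0 (R : realType) (g1 g2 : R[i] -> R[i]) :
  diff_on_Omega g1 -> diff_on_Omega g2 -> indep_images (0 : R[i]) g1 g2.
Proof.
move=> dg1 dg2 B1 B2 mB1 mB2.
have mpre (g : R[i] -> R[i]) (B : set R[i]) : diff_on_Omega g ->
    Defs.measurableC B -> measurable [set t : R | B (g (expi t))].
  move=> /diff_on_Omega_continuous[cRe cIm] mB.
  have mF : measurable_fun setT
      (fun t : R => (complex.Re (g (expi t)), complex.Im (g (expi t)))).
    by apply: measurable_fun_pair; exact: continuous_measurable_fun.
  have := mF measurableT _ mB; rewrite setTI; congr measurable.
  by apply/seteqP; split=> t /=; case: (g _).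
pose k : R := (4 * pi ^+ 2)^-1.
have k0 : 0 <= k by rewrite invr_ge0 mulr_ge0// sqr_ge0.
have densE (zu zv : R[i]) : bc_density 0 zu zv = k.
  rewrite /bc_density !mul0r subr0 ComplexField.Normc.normc0.
  by rewrite ComplexField.Normc.normc1 expr0n/= subr0 expr1n divr1 div1r.
have lawE (A : set (R[i] * R[i])) (I J : set R) : measurable I -> measurable J ->
    (forall t s : R, A (expi t, expi s) <-> I t /\ J s) ->
    bc_law 0 A = (lebesgue_measure (I `&` `[0%R, twopi R]) *
                 (lebesgue_measure (J `&` `[0%R, twopi R]) * k%:E))%E.
  move=> mI mJ AE; apply/eqP; rewrite eq_le; apply/andP; split.
    apply: bc_law_rectangle_le => //; last by move=> *; rewrite densE.
    by rewrite ComplexField.Normc.normc0.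
  by apply: bc_law_rectangle_ge => // *; rewrite densE.
have m2pi : lebesgue_measure ([set: R] `&` `[0%R, twopi R]) = (twopi R)%:E.
  rewrite setTI lebesgue_measure_itv/= lte_fin /twopi.
  by rewrite pmulrn_lgt0// pi_gt0 sube0.
have mI := mpre _ _ dg1 mB1; have mJ := mpre _ _ dg2 mB2.
rewrite (lawE _ _ _ mI mJ)//.
rewrite (lawE [set p | B1 (g1 p.1)] _ _ mI measurableT); last first.
  by move=> t s; split=> [|[]].
rewrite (lawE [set p | B2 (g2 p.2)] _ _ measurableT mJ); last first.
  by move=> t s; split=> [|[]].
rewrite m2pi -!muleA; congr (_ * _)%E.
set y := (_ * k%:E)%E; rewrite 2!muleA -!EFinM.
suff -> : twopi R * k * twopi R = 1 by rewrite mul1e.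
have e (p : R) : p != 0 -> p *+ 2 * (4 * p ^+ 2)^-1 * (p *+ 2) = 1.
  by move=> p0; field.
by apply: e; rewrite gt_eqF// pi_gt0.
Qed.

(** * Monotonicity of the density in the angle difference *)

Lemma cos_homo (R : realType) (x y : R) :
  `|x| <= `|y| -> `|y| <= pi -> cos y <= cos x.
Proof.
have cosE (z : R) : cos `|z| = cos z by case: (ger0P z) => // _; rewrite cosN.
rewrite -(cosE x) -(cosE y) le_eqVlt => /predU1P[->//|xy] ypi.
apply: ltW; rewrite ltr_cos// in_itv/= normr_ge0//=.
exact: le_trans (ltW xy) ypi.
Qed.

(** The Poisson kernel divided by 4 pi^2, as a function of the cosine [c] of the angle. *)
Definition wrapped_cauchy (R : realType) (r c : R) : R :=
  (1 - r ^+ 2) / (1 + r ^+ 2 - 2 * r * c) / (4 * pi ^+ 2).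

(** For [c <= 1] the denominator is at least [(1 - r) ^+ 2 > 0], and it decreases strictly in [c]
    because [r > 0]. *)
Lemma wrapped_cauchy_homo (R : realType) (r : R) : 0 < r < 1 ->
  {in <= 1 &, {homo wrapped_cauchy R r : c c' / c < c'}}.
Proof.
move=> /andP[r0 r1] c c'; rewrite !inE => c1 c'1 cc'; rewrite /wrapped_cauchy.
have pos x : x <= 1 -> 0 < 1 + r ^+ 2 - 2 * r * x.
  move=> x1; have : 0 < (1 - r) ^+ 2 by rewrite exprn_gt0// subr_gt0.
  by have := ler_wpM2l (ltW r0) x1; rewrite expr2; lra.
have p2 : 0 < (4 * pi ^+ 2)^-1 :> R.
  by rewrite invr_gt0 mulr_gt0// exprn_gt0// pi_gt0.
have K0 : 0 < 1 - r ^+ 2 by nra.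
rewrite ltr_pM2r// ltr_pM2l// ltf_pV2 ?posrE ?pos//; nra.
Qed.

Lemma wrapped_cauchy_ge0 (R : realType) (r c : R) : 0 < r < 1 -> c <= 1 ->
  0 <= wrapped_cauchy R r c.
Proof.
move=> /andP[r0 r1] c1; rewrite /wrapped_cauchy.
apply: divr_ge0; last by rewrite mulr_ge0// sqr_ge0.
by apply: divr_ge0; nra.
Qed.

(** * Bounds for products of arcs of equal length *)

Lemma measure_subitv (R : realType) (x e : R) : 0 < x -> 0 < e -> x + e < twopi R ->
  lebesgue_measure (`[x, x + e] `&` `[0%R, twopi R]) = e%:E.
Proof.
move=> x0 e0 xe; rewrite setIidl; last first.
  move=> t /=; rewrite !in_itv/= => /andP[xt te].
  by rewrite (le_trans (ltW x0))//= (le_trans te)// ltW.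
by rewrite lebesgue_measure_itv/= lte_fin ltrDl e0 -EFinB addrAC subrr add0r.
Qed.

(** The real thresholds [u < v] keep the inequality strict for extended reals: the left product is
    at most [u * u], the right one at least [v * v]. *)
Lemma lte_pmul_separated (R : realType) (u v : R) (p1 p2 q1 q2 : \bar R) :
  0 <= u -> u < v -> (0 <= p1)%E -> (0 <= p2)%E ->
  (p1 <= u%:E)%E -> (p2 <= u%:E)%E -> (v%:E <= q1)%E -> (v%:E <= q2)%E ->
  (p1 * p2 < q1 * q2)%E.
Proof.
move=> u0 uv p10 p20 p1u p2u vq1 vq2; have v0 := le_trans u0 (ltW uv).
apply: (le_lt_trans (lee_pmul p10 p20 p1u p2u)).
apply: (@lt_le_trans _ _ (v%:E * v%:E)%E); last by apply: lee_pmul; rewrite ?lee_fin.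
by rewrite -!EFinM lte_fin ltr_pM.
Qed.

Section arcs.
Context (R : realType) (psi : R[i]) (g1 g2 : R[i] -> R[i]) (e : R).
Hypothesis psi1 : ComplexField.Normc.normc psi < 1.
Hypotheses (inj1 : {in @Omega R &, injective g1})
           (inj2 : {in @Omega R &, injective g2}).
Hypothesis e0 : 0 < e.

Definition arc_image (g : R[i] -> R[i]) (x : R) : set R[i] :=
  (g \o expi (R:=R)) @` `[x, x + e].

Let arcs (x y : R) : set (R[i] * R[i]) :=
  [set p | arc_image g1 x (g1 p.1) /\ arc_image g2 y (g2 p.2)].

Let inside (x : R) := 0 < x /\ x + e < twopi R.

Let arcsE (x y t s : R) : inside x -> inside y ->
  `[0, twopi R]%classic t -> `[0, twopi R]%classic s ->
  arcs x y (expi t, expi s) <->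
  `[x, x + e]%classic t /\ `[y, y + e]%classic s.
Proof.
move=> [x0 xe] [y0 ye] Dt Ds.
have h1 := @arc_imageP R g1 x (x + e) t inj1 x0 xe Dt.
have h2 := @arc_imageP R g2 y (y + e) s inj2 y0 ye Ds.
by split=> -[? ?]; split; first [exact/h1|exact/h2].
Qed.

Lemma bc_law_arcs_ge (x y k : R) : inside x -> inside y -> 0 <= k ->
  (forall t s, t \in `[x, x + e] -> s \in `[y, y + e] ->
    k <= bc_density psi (expi t) (expi s)) ->
  ((e * (e * k))%:E <= bc_law psi (arcs x y))%E.
Proof.
move=> ix iy k0 hk; have [x0 xe] := ix; have [y0 ye] := iy.
rewrite !EFinM -{1}(measure_subitv _ x e)// -(measure_subitv _ y e)//.
by apply: bc_law_rectangle_ge => // t s Dt Ds; exact: arcsE.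
Qed.

Lemma bc_law_arcs_le (x y k : R) : inside x -> inside y -> 0 <= k ->
  (forall t s, t \in `[x, x + e] -> s \in `[y, y + e] ->
    bc_density psi (expi t) (expi s) <= k) ->
  (bc_law psi (arcs x y) <= (e * (e * k))%:E)%E.
Proof.
move=> ix iy k0 hk; have [x0 xe] := ix; have [y0 ye] := iy.
rewrite !EFinM -{1}(measure_subitv _ x e)// -(measure_subitv _ y e)//.
by apply: bc_law_rectangle_le => // t s Dt Ds; exact: arcsE.
Qed.

End arcs.

(** * The equivalence, by contradiction on four products of arcs *)

Theorem theorem5 (R : realType) (psi : R[i]) (g1 g2 : R[i] -> R[i]) :
  ComplexField.Normc.normc psi < 1 ->
  {in @Omega R &, injective g1} -> {in @Omega R &, injective g2} ->
  diff_on_Omega g1 -> diff_on_Omega g2 ->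
  (indep_images psi g1 g2 <-> psi = 0).
Proof.
move=> psi1 inj1 inj2 dg1 dg2; split=> [ind|->]; last exact: indep_images0.
apply/eqP/negPn/negP => psi0.
have [a api psiE] := polar _ psi.
set r := ComplexField.Normc.normc psi in psi1 psiE.
have r01 : 0 < r < 1.
  rewrite psi1 andbT lt0r normc_ge0 andbT.
  by apply: contra psi0 => /eqP/ComplexField.Normc.eq0_normc ->.
have p0 := pi_gt0 R.
(* For arcs of length [d], with the second pair shifted by [4 * d], [s - t + a] stays
   within [d] of [0] on the diagonal rectangles and beyond [3 * d] off them. *)
have [d pE] : exists d : R, pi = 16 * d by exists (pi / 16); lra.
have d0 : 0 < d by lra.
have /andP[a1 a2] : - (16 * d) <= a <= 16 * d by rewrite -ler_norml -pE.
have [x [y [xya [x1 x2] [y1 y2]]]] : exists x y : R, [/\ y - x + a = 0,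
    8 * d <= x /\ x <= 24 * d & 8 * d <= y /\ y <= 24 * d].
  (* Splitting [a] evenly around [pi = 16 * d] leaves both base points within [8 * d] of [pi]. *)
  by exists (pi + a / 2), (pi - a / 2); split; lra.
pose k1 := wrapped_cauchy R r (cos d); pose k2 := wrapped_cauchy R r (cos (3 * d)).
have c1 (z : R) : cos z <= 1 by exact: cos_le1.
have k20 : 0 <= k2 by exact: wrapped_cauchy_ge0.
have k21 : k2 < k1.
  apply: wrapped_cauchy_homo; rewrite ?inE ?c1//.
  by rewrite ltr_cos ?in_itv/=; lra.
have densE t s : bc_density psi (expi t) (expi s) =
    wrapped_cauchy R r (cos (s - t + a)).
  by rewrite psiE bc_densityE.
have wle c c' : c <= c' -> c' <= 1 -> wrapped_cauchy R r c <= wrapped_cauchy R r c'.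
  rewrite le_eqVlt => /predU1P[->//|cc'] c'1; apply/ltW/wrapped_cauchy_homo => //.
  by rewrite inE (le_trans (ltW cc')).
have twoE : twopi R = 32 * d by rewrite /twopi pE; lra.
(* The bound [28 * d] is [24 * d] plus the shift [4 * d], so one fact serves both the original and
   the shifted base points. *)
have inside z : 8 * d <= z -> z <= 28 * d -> 0 < z /\ z + d < twopi R.
  by move=> *; rewrite twoE; split; lra.
(* Since [t - u] and [s - v] lie in [0, d], the angle [s - t + a] differs from [v - u + a] by at
   most [d]. *)
have near u v t s : v - u + a = 0 ->
    t \in `[u, u + d] -> s \in `[v, v + d] -> k1 <= bc_density psi (expi t) (expi s).
  rewrite !in_itv/= densE => uv /andP[ut tu] /andP[vs sv]; apply: wle => //.
  by apply: cos_homo; rewrite (ger0_norm (ltW d0)) ?ler_norml; lra.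
(* Here [|s - t + a|] lies between [3 * d] and [5 * d], still below [pi], where the cosine decreases
   with the absolute value of the angle. *)
have far u v t s : v - u + a = 4 * d \/ v - u + a = - (4 * d) ->
    t \in `[u, u + d] -> s \in `[v, v + d] -> bc_density psi (expi t) (expi s) <= k2.
  rewrite !in_itv/= densE => uv /andP[ut tu] /andP[vs sv]; apply: wle => //.
  have h3 : `|3 * d| = 3 * d by rewrite ger0_norm//; lra.
  apply: cos_homo; last by rewrite ler_norml; case: uv => uv; lra.
  by rewrite h3 ler_normr; apply/orP; case: uv => uv; [left|right]; lra.
pose B1 := arc_image R d g1; pose B2 := arc_image R d g2.
(* Kept opaque: unification would otherwise unfold the integrals. *)
have [P PE] : exists P : R -> R -> \bar R,
    forall u v, P u v = bc_law psi [set p | B1 u (g1 p.1) /\ B2 v (g2 p.2)].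
  by eexists.
have [x' x'E] : exists x', x' = x + 4 * d by exists (x + 4 * d).
have [y' y'E] : exists y', y' = y + 4 * d by exists (y + 4 * d).
have exch : (P x y * P x' y' = P x y' * P x' y)%E.
  by rewrite !PE; apply: indep_images_exchange => //; exact: measurableC_arc_image.
have [ix iy] : (0 < x /\ x + d < twopi R) /\ (0 < y /\ y + d < twopi R).
  by split; apply: inside; lra.
have [ix' iy'] : (0 < x' /\ x' + d < twopi R) /\ (0 < y' /\ y' + d < twopi R).
  by split; apply: inside; lra.
have k10 : 0 <= k1 := le_trans k20 (ltW k21).
have l1 : ((d * (d * k1))%:E <= P x y)%E.
  by rewrite PE; apply: (bc_law_arcs_ge _ _ _ _ _ inj1 inj2 d0 _ _ _ ix iy k10)
    => t s; exact: near.
have l2 : ((d * (d * k1))%:E <= P x' y')%E.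
  have e : y' - x' + a = 0 by lra.
  by rewrite PE; apply: (bc_law_arcs_ge _ _ _ _ _ inj1 inj2 d0 _ _ _ ix' iy' k10)
    => t s; exact: near.
have l3 : (P x y' <= (d * (d * k2))%:E)%E.
  have e : y' - x + a = 4 * d by lra.
  by rewrite PE; apply: (bc_law_arcs_le _ _ _ _ _ psi1 inj1 inj2 d0 _ _ _ ix iy' k20)
    => t s; apply: far; left.
have l4 : (P x' y <= (d * (d * k2))%:E)%E.
  have e : y - x' + a = - (4 * d) by lra.
  by rewrite PE; apply: (bc_law_arcs_le _ _ _ _ _ psi1 inj1 inj2 d0 _ _ _ ix' iy k20)
    => t s; apply: far; right.
have P0 u v : (0 <= P u v)%E by rewrite PE; exact: bc_law_ge0.
have k2d : 0 <= d * (d * k2) := mulr_ge0 (ltW d0) (mulr_ge0 (ltW d0) k20).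
have k21d : d * (d * k2) < d * (d * k1) by rewrite !(ltr_pM2l d0).
(* The off-diagonal product is strictly below the diagonal one, while [exch] says that they are
   equal. *)
have := lte_pmul_separated _ _ _ _ _ _ _ k2d k21d (P0 _ _) (P0 _ _) l3 l4 l1 l2.
by rewrite exch ltxx.
Qed.
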